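(* Let $n \ge 1$ and let $L$ be a finite graded lattice of rank $n$, with minimum element $\hat{0}$, maximum element $\hat{1}$ and rank function $\rho$, and let $\bar{L} = L \setminus \{\hat{0}, \hat{1}\}$ be its proper part. Let $\Bbbk$ be a fixed field or $\mathbb{Z}$. If $\widetilde{H}_{n-2}(\Delta(\bar{L}); \Bbbk) \ne 0$, then $$ f_L(S) \ \ge\ \alpha_n(S) $$ for every $S \subseteq [n-1]$. In other words, the Boolean algebra $B_n$ of rank $n$ minimizes the flag $f$-vector among all finite graded lattices of rank $n$ whose proper part has nontrivial top-dimensional reduced homology over $\Bbbk$.
   Context: For a finite poset $Q$, $\Delta(Q)$ denotes its order complex, the simplicial complex of all chains of $Q$; $\widetilde{H}_*(\Delta;\Bbbk)$ denotes reduced simplicial homology with coefficients in $\Bbbk$. For a finite graded poset $P$ of rank $n$ with $\hat 0,\hat 1$ and rank function $\rho$, and $S \subseteq [n-1] = \{1,\dots,n-1\}$, $f_P(S)$ is the number of chains $\mathcal{C} \subseteq P \setminus \{\hat{0},\hat{1}\}$ with $\{\rho(x) : x \in \mathcal{C}\} = S$ (the flag $f$-vector of $P$). For $S = \{s_1 < \cdots < s_l\} \subseteq [n-1]$, $\alpha_n(S)$ is the multinomial coefficient $\binom{n}{s_1, s_2 - s_1, \dots, n - s_l}$, which equals $f_{B_n}(S)$, where $B_n$ is the lattice of subsets of $[n]$ ordered by inclusion. *)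

(* Defs.v *)
From HB Require Import structures.
From mathcomp Require Import all_boot all_order all_algebra.
From mathcomp Require Import ring_quotient.
From mathcomp Require Import boolp.

Set Implicit Arguments.
Unset Strict Implicit.
Unset Printing Implicit Defensive.

Import Order.TTheory GRing.Theory Num.Theory.

Local Open Scope ring_scope.

Section Posets.
Variables (d : Order.disp_t) (P : finTBPOrderType d).
Implicit Types (x y z : P) (C : {set P}).

Definition is_chain C : bool :=
  [forall x in C, forall y in C, (x >=< y)%O].

Definition covered_by x y : bool :=
  (x < y)%O && [forall z, ~~ (x < z < y)%O].

(* A chain of length n has n + 1 elements. *)
Definition graded_of_rank (n : nat) : Prop :=
  forall C, maxset is_chain C -> #|C| = n.+1.

Definition rank_function (rho : P -> nat) : Prop :=
  rho \bot%O = 0%N /\ forall x y, covered_by x y -> rho y = (rho x).+1.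

Definition proper_part : {set P} := [set x | x != \bot%O & x != \top%O].

(* The empty chain is included, as the face of dimension -1. *)
Definition order_complex (A : {set P}) : {set {set P}} :=
  [set C | is_chain C & C \subset A].

(* S is a set of natural numbers smaller than n; the two quantified conditions
   say that rho maps C onto S. *)
Definition flag_f (rho : P -> nat) (n : nat) (S : {set 'I_n}) : nat :=
  #|[set C : {set P} | [&& is_chain C, C \subset proper_part,
      [forall x in C, exists s in S, rho x == s]
    & [forall s in S, exists x in C, rho x == s]]]|.

End Posets.

Arguments graded_of_rank {d} P n.
Arguments proper_part {d} P.

Definition multinomial (ks : seq nat) : nat :=
  ((sumn ks)`! %/ \prod_(k <- ks) k`!)%N.

(* [enum S] lists S = {s_1 < ... < s_l} increasingly, so the arguments of the
   multinomial are s_1, s_2 - s_1, ..., n - s_l, and just n if S is empty. *)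
Definition alpha (n : nat) (S : {set 'I_n}) : nat :=
  multinomial
    (pairmap (fun a b => b - a)%N 0%N (rcons [seq val s | s <- enum S] n)).

Section Homology.
Variables (T : finType) (k : comNzRingType) (K : {set {set T}}).
Implicit Types (i j : int).

(* A face with m vertices has dimension m - 1; the empty face has dimension -1,
   which makes the homology below the reduced one. *)
Definition face i : Type := {F : {set T} | (F \in K) && (#|F|%:Z - 1 == i)}.

HB.instance Definition _ i := SubFinite.on (face i).

Definition chain_group i : Type := {ffun face i -> k}.

HB.instance Definition _ i := GRing.Zmodule.on (chain_group i).

(* The coefficient of G in the boundary of F, each face being oriented by the
   order in which T is enumerated: if F = {x_0, ..., x_m} in that order, it is
   (-1)^r if G = F \ {x_r}, and 0 if G is not a facet of F. *)
Definition incidence (F G : {set T}) : k :=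
  \sum_(x in F | F :\ x == G)
    (-1) ^+ #|[set y in F | (enum_rank y < enum_rank x)%N]|.

(* The intended use is j = i - 1. The target degree is a separate parameter
   because i + 1 - 1 and i are not convertible. *)
Definition boundary i j (c : chain_group i) : chain_group j :=
  [ffun G : face j => \sum_(F : face i) incidence (val F) (val G) * c F].

Lemma boundary_is_zmod_morphism i j : zmod_morphism (@boundary i j).
Proof.
move=> a b; apply/ffunP=> G; rewrite !ffunE -sumrB.
by apply: eq_bigr => F _; rewrite !ffunE mulrBr.
Qed.

HB.instance Definition _ i j :=
  GRing.isZmodMorphism.Build (chain_group i) (chain_group j) (@boundary i j)
    (@boundary_is_zmod_morphism i j).

Definition is_cycle i : {pred chain_group i} :=
  fun z => boundary (i - 1) z == 0.

Lemma is_cycle_zmod_closed i : zmod_closed (@is_cycle i).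
Proof.
split=> [|a b]; rewrite !unfold_in ?raddf0 //.
by rewrite raddfB /= => /eqP-> /eqP->; rewrite subr0.
Qed.

HB.instance Definition _ i :=
  GRing.isZmodClosed.Build (chain_group i) (@is_cycle i)
    (@is_cycle_zmod_closed i).

Record cycle_group i := Cycle {
  cycle_val :> chain_group i;
  _ : cycle_val \in @is_cycle i }.

HB.instance Definition _ i := [isSub for @cycle_val i].
HB.instance Definition _ i := [Choice of cycle_group i by <:].
HB.instance Definition _ i :=
  [SubChoice_isSubZmodule of cycle_group i by <:].

Definition is_boundary i : {pred cycle_group i} :=
  fun z => `[< exists c : chain_group (i + 1), boundary i c = val z >].

Lemma is_boundary_zmod_closed i : zmod_closed (@is_boundary i).
Proof.
split=> [|a b]; rewrite !unfold_in.
  by apply/asboolP; exists 0; rewrite !raddf0.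
move=> /asboolP[a' ea] /asboolP[b' eb]; apply/asboolP; exists (a' - b').
by rewrite !raddfB /= ea eb.
Qed.

HB.instance Definition _ i :=
  GRing.isZmodClosed.Build (cycle_group i) (@is_boundary i)
    (@is_boundary_zmod_closed i).

(* The underlying abelian group of the i-th reduced homology module. *)
Definition reduced_homology i : zmodType := Quotient.quot (@is_boundary i).

End Homology.

Arguments reduced_homology {T} k K i.

Variant field_or_Z : comNzRingType -> Prop :=
| is_field (F : fieldType) : field_or_Z F
| is_Z : field_or_Z int.

(* Main.v *)
(* Since maximal chains of the proper part have n - 1 elements, a nonzero class
   in degree n - 2 is a nonzero cycle, and the maximal chains in its support form
   a family in which every element of a member can be exchanged for another one
   (otherwise the boundary would not vanish at the corresponding ridge). Such
   families restrict to the intervals [0, x] and [x, 1]. Given an atom a,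
   exchanges lead from any member to one whose coatom c is not above a: the first
   element of a chain above a is the join of a with its predecessor, so it can
   only be replaced by an element not above a. As [a, 1] and [0, c] are then
   disjoint, Pascal's rule yields at least binomial(n, r) elements of rank r in
   the support, and the multinomial bound follows by building flags from the
   bottom, one rank at a time. *)

Require Import Defs.
From mathcomp Require Import all_boot all_order all_algebra.
From mathcomp Require Import boolp zify.

Set Implicit Arguments.
Unset Strict Implicit.
Unset Printing Implicit Defensive.

Import Order.TTheory GRing.Theory Num.Theory.

Local Open Scope ring_scope.

(** * Multinomial coefficients as iterated binomial coefficients *)

Section Multinomial.

(** The product of the factorials divides the factorial of the sum, so the truncating division in
    [multinomial] is exact. *)
Lemma multinomialM (ks : seq nat) :
  (multinomial ks * \prod_(k <- ks) k`! = (sumn ks)`!)%N.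
Proof.
rewrite /multinomial divnK //.
elim: ks => [|k ks IH]; first by rewrite big_nil.
rewrite big_cons /= -(bin_fact (leq_addr (sumn ks) k)) addKn.
by rewrite dvdn_mull // dvdn_mul.
Qed.

Lemma multinomial_cons (k : nat) (ks : seq nat) :
  multinomial (k :: ks) = ('C(k + sumn ks, k) * multinomial ks)%N.
Proof.
have prod_gt0 : (0 < \prod_(j <- k :: ks) j`!)%N.
  by apply: prodn_gt0 => j; rewrite fact_gt0.
apply/eqP; rewrite -(eqn_pmul2r prod_gt0) multinomialM /= big_cons.
rewrite -(bin_fact (leq_addr (sumn ks) k)) addKn -(multinomialM ks).
by apply/eqP; lia.
Qed.

(** The gaps telescope; since the list increases, no subtraction is truncated. *)
Lemma sumn_pairmap_sub (a : nat) (l : seq nat) :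
  path ltn a l -> sumn (pairmap (fun x y => y - x)%N a l) = (last a l - a)%N.
Proof.
elim: l a => [|b l IH] a /=; first by rewrite subnn.
move=> /andP[ab bl]; rewrite (IH _ bl).
have: (b <= last b l)%N.
  have := mem_last b l; rewrite in_cons => /predU1P[->//|].
  by move: bl => /(order_path_min ltn_trans)/allP lt_bl /lt_bl/ltnW.
lia.
Qed.

End Multinomial.

Lemma lt_sorted_rconsE (d : Order.disp_t) (T : porderType d) (s : seq T) (x : T) :
  sorted <%O (rcons s x) = all (fun y => y < x)%O s && sorted <%O s.
Proof. by rewrite !lt_sorted_pairwise pairwise_rcons. Qed.

(** * Families of maximal chains with the exchange property, and their rank levels *)

Section ThickFamilies.
Variables (d : Order.disp_t) (L : finTBLatticeType d).
Variable (rho : L -> nat).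
Hypothesis rank_rho : rank_function rho.
Implicit Types (u v x y a c : L) (s t : seq L) (M : seq L -> Prop).

(* A nonempty family of maximal chains of the open interval ]u, v[ without free
   ridges: every element of a member can be exchanged within the family. *)
Definition thick M u v : Prop :=
  [/\ exists s, M s,
      forall s, M s -> path (@covered_by d L) u (rcons s v)
    & forall s1 x s2, M (s1 ++ x :: s2) ->
        exists2 y, y != x & M (s1 ++ y :: s2)].

(** The ends [u] and [v] are counted in, so that the binomial bound also covers the extreme
    ranks. *)
Definition thick_support M u v x : Prop :=
  exists2 s, M s & x \in u :: rcons s v.

(** The part from [x] upward is frozen, so exchanges below [x] stay in the family. This and the dual
    statement for [x] and [v] supply the smaller intervals of the inductions. *)
Lemma thick_below M u v s1 x s2 :
  thick M u v -> M (s1 ++ x :: s2) ->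
  thick (fun s => M (s ++ x :: s2)) u x.
Proof.
case=> _ pM exM Mx; split; first by exists s1.
  by move=> s /pM; rewrite rcons_cat cat_path (rcons_path _ _ s) => /and3P[-> ->].
by move=> t1 y t2; rewrite -catA /= => /exM[z zy]; exists z; rewrite // -catA.
Qed.

Lemma thick_above M u v s1 x s2 :
  thick M u v -> M (s1 ++ x :: s2) ->
  thick (fun s => M (s1 ++ x :: s)) x v.
Proof.
case=> _ pM exM Mx; split; first by exists s2.
  by move=> s /pM; rewrite rcons_cat /= cat_path /= => /and3P[].
move=> t1 y t2; rewrite -cat_cons catA => /exM[z zy]; exists z => //.
by rewrite -cat_cons catA.
Qed.

Lemma covered_by_lt x y : covered_by x y -> (x < y)%O.
Proof. by case/andP. Qed.

(** The join lies strictly above [x] and weakly below [y], and a cover leaves nothing in between. *)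
Lemma covered_by_join x y a :
  covered_by x y -> ~~ (a <= x)%O -> (a <= y)%O -> y = (x `|` a)%O.
Proof.
move=> /andP[xy /forallP/(_ (x `|` a)%O) nb] nax ay.
have le_y : (x `|` a <= y)%O by rewrite leUx ay (ltW xy).
move: nb; rewrite (lt_neqAle x) leUl andbT eq_sym eq_joinl nax /=.
by rewrite lt_neqAle le_y andbT negbK => /eqP.
Qed.

(* Replacing the first element of a chain lying above [a], which is forced to be
   the join of [a] and its predecessor, moves the entry point of the chain into
   the filter of [a] one step up. *)
Lemma thick_coatom_notin_filter M u v a :
  thick M u v -> ~~ (a <= u)%O -> exists2 s, M s & ~~ (a <= last u s)%O.
Proof.
case=> [[s0 Ms0] pM exM] nau.
suff H s2 s1 : M (s1 ++ s2) -> ~~ (a <= last u s1)%O ->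
    exists2 s, M s & ~~ (a <= last u s)%O by exact: (H s0 [::]).
elim: s2 s1 => [|x s2 IH] s1 Ms nas; first by exists s1; rewrite // -[s1]cats0.
have [ax|nax] := boolP (a <= x)%O; last first.
  by apply: (IH (rcons s1 x)); rewrite ?cat_rcons ?last_rcons.
have [y yx My] := exM _ _ _ Ms.
apply: (IH (rcons s1 y)); rewrite ?cat_rcons ?last_rcons //.
apply/negP=> ay; case/eqP: yx.
have cov z : M (s1 ++ z :: s2) -> covered_by (last u s1) z.
  by move/pM; rewrite rcons_cat cat_path /= => /and3P[].
by rewrite (covered_by_join (cov _ Ms) nas ax) (covered_by_join (cov _ My) nas ay).
Qed.

Lemma rho_path u s : path (@covered_by d L) u s ->
  rho (last u s) = (rho u + size s)%N.
Proof.
elim: s u => [|x s IH] u /=; first by rewrite addn0.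
by case/andP=> /(rank_rho.2) rx /IH ->; rewrite rx addSnnS.
Qed.

Lemma map_rho_path u s : path (@covered_by d L) u s ->
  map rho s = iota (rho u).+1 (size s).
Proof.
elim: s u => //= x s IH u /andP[/(rank_rho.2) rx /IH ->].
by rewrite rx.
Qed.

Lemma path_covered_lt u s : path (@covered_by d L) u s -> path <%O u s.
Proof. by apply: sub_path => x y /covered_by_lt. Qed.

Lemma path_covered_ge u s x :
  path (@covered_by d L) u s -> x \in u :: s -> (u <= x)%O.
Proof.
move=> /path_covered_lt; rewrite lt_path_sortedE => /andP[/allP lt_us _].
by rewrite inE => /predU1P[->//|/lt_us/ltW].
Qed.

Lemma path_covered_le u s v x :
  path (@covered_by d L) u (rcons s v) -> x \in u :: rcons s v -> (x <= v)%O.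
Proof.
move=> /path_covered_lt; rewrite -[path _ _ _]/(sorted <%O (rcons (u :: s) v)).
rewrite lt_sorted_rconsE => /andP[/allP lt_sv _].
by rewrite -rcons_cons mem_rcons inE => /predU1P[->//|/lt_sv/ltW].
Qed.

Definition rank_level M u v (r : nat) : {set L} :=
  [set x | `[< thick_support M u v x >] & rho x == (rho u + r)%N].

Lemma rank_levelP M u v r x :
  reflect (thick_support M u v x /\ rho x = (rho u + r)%N)
          (x \in rank_level M u v r).
Proof.
rewrite inE; apply: (iffP andP) => [[/asboolP sx /eqP rx]|[sx rx]] //.
by split; [apply/asboolP | apply/eqP].
Qed.

(* Pascal's rule: for an atom [a] and a coatom [c] of the family with
   [~~ (a <= c)], the intervals [a, v] and [u, c] are disjoint. *)
Lemma leq_bin_rank_level m M u v r :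
  thick M u v -> rho v = (rho u + m)%N -> ('C(m, r) <= #|rank_level M u v r|)%N.
Proof.
elim: m M u v r => [|m IH] M u v [|r] tM rv; rewrite ?bin0 //.
- apply/card_gt0P; exists u; apply/rank_levelP; rewrite addn0; split=> //.
  by case: tM => [[s Ms] _ _]; exists s; rewrite ?mem_head.
- apply/card_gt0P; exists u; apply/rank_levelP; rewrite addn0; split=> //.
  by case: tM => [[s Ms] _ _]; exists s; rewrite ?mem_head.
(* In the remaining case [r < m], so [m] is positive and every member has a first and a last
   element. *)
case: (ltngtP r m) => [rm|mr|->]; last 2 first.
- by rewrite bin_small.
- rewrite binn; apply/card_gt0P; exists v; apply/rank_levelP; split=> //.
  case: tM => [[s Ms] _ _]; exists s => //.
  by rewrite inE mem_rcons mem_head orbT.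
have [[s Ms] pM _] := tM.
have sizeM t : M t -> size t = m.
  by move/pM/rho_path; rewrite last_rcons rv size_rcons => /addnI[].
case: s Ms => [/sizeM/= m0|a s Ms]; first by rewrite -m0 in rm.
have cov_ua : covered_by u a by have /= /andP[] := pM _ Ms.
have nau : ~~ (a <= u)%O by rewrite lt_geF // covered_by_lt.
have [t Mt] := thick_coatom_notin_filter tM nau.
case/lastP: t Mt => [/sizeM/= m0|t c Mt]; first by rewrite -m0 in rm.
rewrite last_rcons => nac.
have rv' : rho v = (rho a + m)%N by rewrite rv (rank_rho.2 _ _ cov_ua) addnS.
have pt := pM _ Mt.
have rc : rho c = (rho u + m)%N.
  move: pt; rewrite -cats1 cat_path => /andP[/rho_path].
  by rewrite last_rcons (sizeM _ Mt).
have tA := thick_above (s1 := [::]) tM Ms.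
have Mt' : M (t ++ [:: c]) by rewrite cats1.
have tC := thick_below tM Mt'.
(* Rank [r.+1] over [u] is rank [r] over [a]: the two summands of Pascal's rule count support
   elements above [a] and below [c]. *)
rewrite binS addnC.
apply: leq_trans (leq_add (IH _ _ _ r tA rv') (IH _ _ _ r.+1 tC rc)) _.
set A := rank_level _ a v r; set B := rank_level _ u c r.+1.
have dAB : A :&: B = set0.
  apply/setP=> x; rewrite in_setI in_set0; apply/andP=> -[].
  move=> /rank_levelP[[s1 Ms1 xs1] _] /rank_levelP[[s2 Ms2 xs2] _].
  case/negP: nac; apply: (@le_trans _ _ x).
    by apply: path_covered_ge xs1; case: tA => _ pA _; exact: pA.
  by apply: path_covered_le xs2; case: tC => _ pC _; exact: pC.
have -> : (#|A| + #|B| = #|A :|: B|)%N by rewrite cardsU dAB cards0 subn0.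
apply: subset_leq_card; apply/subsetP=> x; rewrite in_setU.
case/orP=> /rank_levelP[[s1 Ms1 xs1] rx]; apply/rank_levelP; split=> //.
- by exists (a :: s1); rewrite // rcons_cons in_cons xs1 orbT.
- by rewrite rx (rank_rho.2 _ _ cov_ua) addSnnS.
exists (s1 ++ [:: c]) => //.
by rewrite cats1 -rcons_cons mem_rcons in_cons xs1 orbT.
Qed.

(** * Counting flags rank by rank from the bottom *)

(** A version of the flags in [flag_f] with a movable bottom [u]; keeping the ranks in a list lets
    the induction peel off the lowest one. *)
Definition flags_above u (l : seq nat) : {set {set L}} :=
  [set C : {set L} | [&& is_chain C,
      [forall x in C, (u < x)%O && (rho x \in l)]
    & all (fun r => [exists x in C, rho x == r]) l]].

Lemma flags_aboveP u l (C : {set L}) :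
  reflect [/\ is_chain C, {in C, forall x, (u < x)%O /\ rho x \in l}
            & {in l, forall r, exists2 x, x \in C & rho x = r}]
          (C \in flags_above u l).
Proof.
rewrite inE; apply: (iffP and3P) => -[cC hC hl]; split=> //.
- by move=> x xC; move/forall_inP: hC => /(_ x xC)/andP.
- by move=> r rl; move/allP: hl => /(_ r rl)/exists_inP[x xC /eqP]; exists x.
- by apply/forall_inP => x /hC[-> ->].
by apply/allP => r /hl[x xC rx]; apply/exists_inP; exists x => //; apply/eqP.
Qed.

Lemma chain_setU1 x (C : {set L}) :
  is_chain C -> {in C, forall y, (x >=< y)%O} -> is_chain (x |: C).
Proof.
move=> /forall_inP cC cx; apply/forall_inP => y /setU1P[->|yC];
  apply/forall_inP => z /setU1P[->|zC].
- exact: comparablexx.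
- exact: cx.
- by rewrite comparable_sym cx.
by move: (cC _ yC) => /forall_inP; apply.
Qed.

Lemma flags_above_cons u x l (C : {set L}) :
  (u < x)%O -> C \in flags_above x l -> x |: C \in flags_above u (rho x :: l).
Proof.
move=> ux /flags_aboveP[cC hC hl]; apply/flags_aboveP; split.
- by apply: chain_setU1 => // y /hC[/ltW xy _]; rewrite /Order.comparable xy.
- move=> y /setU1P[->|/hC[xy yl]]; first by rewrite mem_head.
  by rewrite in_cons yl orbT (lt_trans ux xy).
move=> r; rewrite in_cons => /predU1P[->|/hl[y yC ry]].
  by exists x; rewrite ?setU11.
by exists y; rewrite // setU1r.
Qed.

(** The lowest rank [r] contains binomially many support elements. For each such [x], the members
    sharing a fixed initial part up to [x] form a thick family above [x], to which the induction
    hypothesis applies. *)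
Lemma leq_multinomial_flags M u v l :
  thick M u v -> path ltn (rho u) (rcons l (rho v)) ->
  (multinomial (pairmap (fun i j => j - i) (rho u) (rcons l (rho v)))
    <= #|flags_above u l|)%N.
Proof.
elim: l M u => [|r l IH] M u tM.
  move=> _; rewrite /= multinomial_cons addn0 binn mul1n.
  rewrite /multinomial big_nil divn1 /= fact0.
  apply/card_gt0P; exists set0; apply/flags_aboveP; split=> //.
    by apply/forall_inP => x; rewrite in_set0.
  by move=> x; rewrite in_set0.
rewrite rcons_cons /= => /andP[ur pr].
have srt := pr; rewrite (path_sortedE ltn_trans) in srt.
case/andP: srt => /allP r_lt _.
have r_v : (r < rho v)%N by apply: r_lt; rewrite mem_rcons mem_head.
rewrite multinomial_cons (sumn_pairmap_sub pr) last_rcons.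
have -> : (r - rho u + (rho v - r) = rho v - rho u)%N by lia.
set X := rank_level M u v (r - rho u).
have cX : ('C(rho v - rho u, r - rho u) <= #|X|)%N.
  by apply: leq_bin_rank_level => //; lia.
set A := flags_above u (r :: l).
pose above x := [set x |: C | C in flags_above x l].
(* Double counting of pairs formed by a support element [x] of rank [r] and a flag obtained by
   adding [x] to a flag above it. *)
apply: (@leq_trans (\sum_(x in X) #|[set C in A | C \in above x]|)).
  apply: leq_trans (leq_mul cX (leqnn _)) _.
  rewrite -sum_nat_const; apply: leq_sum => x /rank_levelP[[s Ms xs] rx].
  have {}rx : rho x = r by lia.
  have {}xs : x \in s.
    move: xs; rewrite in_cons mem_rcons in_cons => /or3P[/eqP xE|/eqP xE|//].
      by rewrite -xE rx ltnn in ur.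
    by rewrite -xE rx ltnn in r_v.
  have ux : (u < x)%O.
    have [_ /(_ _ Ms)/path_covered_lt p _] := tM.
    move: p; rewrite lt_path_sortedE => /andP[/allP + _]; apply.
    by rewrite mem_rcons in_cons xs orbT.
  case/splitPr: xs Ms => s1 s2 Ms.
  rewrite -rx; apply: leq_trans (IH _ _ (thick_above tM Ms) _) _.
    by rewrite rx.
  have inj : {in flags_above x l &, injective (fun C => x |: C)}.
    move=> C D /flags_aboveP[_ hC _] /flags_aboveP[_ hD _] eqCD.
    have xnC : x \notin C by apply/negP => /hC[]; rewrite ltxx.
    have xnD : x \notin D by apply/negP => /hD[]; rewrite ltxx.
    by rewrite -(setU1K xnC) eqCD setU1K.
  rewrite -(card_in_imset inj); apply: subset_leq_card.
  apply/subsetP=> D Dx; rewrite inE Dx andbT; case/imsetP: Dx => C hC ->.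
  by rewrite /A -rx; exact: flags_above_cons.
under eq_bigr do rewrite -sum1dep_card.
rewrite (exchange_big_dep (fun C => C \in A)) /=; last by move=> x C _ /andP[].
rewrite -sum1_card; apply: leq_sum => C CA.
(* A flag determines its [x]: all its other elements have ranks in [l], hence larger than [r]. *)
rewrite sum1dep_card; apply/card_le1_eqP => y x.
rewrite in_set => /and3P[_ _ /imsetP[C2 /flags_aboveP[_ hC2 _] eC2]].
rewrite in_set => /and3P[/rank_levelP[_ rx] _ /imsetP[C1 _ eC1]].
have : x \in C by rewrite eC1 setU11.
rewrite eC2 => /setU1P[//|/hC2[_ rxl]].
have := r_lt (rho x); rewrite mem_rcons in_cons rxl orbT => /(_ isT); lia.
Qed.

End ThickFamilies.

(** * Facets of the order complex as saturated chains from bottom to top *)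

Section SaturatedChains.
Variables (d : Order.disp_t) (L : finTBLatticeType d).
Implicit Types (u x y z : L) (s : seq L) (C F : {set L}).

Lemma sorted_lt_is_chain s : sorted <%O s -> is_chain [set x in s].
Proof.
move=> ss; apply/forall_inP => x; rewrite inE => xs; apply/forall_inP => y.
rewrite inE => ys; rewrite -(nth_index x xs) -(nth_index x ys) /Order.comparable.
by rewrite !(lt_sorted_leq_nth x ss) ?inE ?index_mem // leq_total.
Qed.

(** A point strictly between two consecutive terms is comparable to all terms, so by maximality it
    is itself a term, with an index strictly between two consecutive integers. *)
Lemma path_covered_of_maxset u s :
  path <%O u s -> maxset (@is_chain d L) [set x in u :: s] ->
  path (@covered_by d L) u s.
Proof.
move=> p /maxsetP[cC maxC]; apply/(pathP u) => i lt_is.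
have ss : sorted <%O (u :: s) by [].
have lt_nth j k : (j < size (u :: s))%N -> (k < size (u :: s))%N ->
    (nth u (u :: s) j < nth u (u :: s) k)%O = (j < k)%N.
  by move=> js ks; rewrite (lt_sorted_ltn_nth u ss).
have le_nth j k : (j < size (u :: s))%N -> (k < size (u :: s))%N ->
    (nth u (u :: s) j <= nth u (u :: s) k)%O = (j <= k)%N.
  by move=> js ks; rewrite (lt_sorted_leq_nth u ss).
rewrite -[nth u s i]/(nth u (u :: s) i.+1).
apply/andP; split; first by rewrite lt_nth //= ltnS ltnW.
apply/forallP => z; apply/negP => /andP[iz zi].
have eqC : z |: [set x in u :: s] = [set x in u :: s].
  apply: maxC; last exact: subsetUr.
  apply: chain_setU1 => // y; rewrite inE => /(nthP u)[j js <-].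
  case: (leqP j i) => ji; rewrite /Order.comparable.
    by rewrite (ltW (le_lt_trans _ iz)) ?orbT // le_nth //= ltnS ltnW.
  by rewrite (ltW (lt_le_trans zi _)) // le_nth.
have : z \in [set x in u :: s] by rewrite -eqC setU11.
rewrite inE => /(nthP u)[k ks kz].
move: iz zi; rewrite -kz !lt_nth //=; last by rewrite ltnS ltnW.
lia.
Qed.

Variables (n : nat).
Hypotheses (n_gt0 : (0 < n)%N) (gradedL : graded_of_rank L n).

Lemma graded_bot_lt_top : (\bot < \top :> L)%O.
Proof.
rewrite lt_neqAle le0x andbT; apply/negP => /eqP bt.
have [C maxC] : {C | maxset (@is_chain d L) C}.
  apply: ex_maxset; exists set0; apply/forall_inP => x; by rewrite in_set0.
have := gradedL maxC; suff : (#|C| <= 1)%N by lia.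
apply/card_le1_eqP => x y _ _.
have eqb z : z = \bot%O by apply/le_anti; rewrite le0x andbT bt lex1.
by rewrite (eqb x) (eqb y).
Qed.

(** Sort [F] and add both bounds: the result has [n.+1] elements, as many as every maximal chain, so
    it is maximal and its consecutive terms are covers. *)
Lemma graded_chain_saturated F :
  F \in order_complex (proper_part L) -> #|F| = n.-1 ->
  exists2 s, path (@covered_by d L) \bot%O (rcons s \top%O) & s =i F.
Proof.
rewrite inE => /andP[cF /subsetP sF] cardF; pose s := sort <=%O (enum F).
have sE : s =i F by move=> x; rewrite mem_sort mem_enum.
have ss : sorted <%O s.
  rewrite lt_sorted_uniq_le sort_uniq enum_uniq /=.
  apply: (@sort_sorted_in _ (mem F)); last by apply/allP=> x; rewrite mem_enum.
  by move=> x y xF yF; move/forall_inP: cF => /(_ x xF)/forall_inP/(_ y yF).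
have p : path <%O \bot%O (rcons s \top%O : seq L).
  rewrite lt_path_sortedE lt_sorted_rconsE ss andbT all_rcons.
  rewrite graded_bot_lt_top /=; apply/andP; split; apply/allP => x; rewrite sE.
    by move/sF; rewrite inE => /andP[x0 _]; rewrite lt0x.
  by move/sF; rewrite inE => /andP[_ x1]; rewrite ltx1.
exists s => //; apply: path_covered_of_maxset => //.
have cC := @sorted_lt_is_chain (\bot%O :: rcons s \top%O) p.
have [C maxC sC] := maxset_exists cC.
suff -> : [set x in \bot%O :: rcons s \top%O] = C by [].
apply/eqP; rewrite eqEcard sC (gradedL maxC) cardsE.
rewrite (card_uniqP (lt_sorted_uniq (s := _ :: _) p)) /= size_rcons size_sort -cardE cardF.
lia.
Qed.

End SaturatedChains.

(** * From a nonzero homology class to a thick family *)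

Section SupportOfCycle.
Variables (d : Order.disp_t) (L : finTBLatticeType d) (rho : L -> nat).
Variables (n : nat) (k : comNzRingType).
Hypotheses (n_gt0 : (0 < n)%N) (gradedL : graded_of_rank L n).
Hypothesis rank_rho : rank_function rho.
Let K := order_complex (proper_part L).

Lemma incidence_neq0 (T : finType) (F G : {set T}) :
  incidence k F G != 0 -> exists2 x, x \in F & F :\ x = G.
Proof.
move=> nz; suff /exists_inP[x xF /eqP] : [exists x in F, F :\ x == G] by exists x.
apply: contraNT nz => /exists_inPn noF; rewrite /incidence big1 // => x /andP[xF].
by rewrite (negPf (noF x xF)).
Qed.

Lemma incidenceD1 (T : finType) (F : {set T}) x : x \in F ->
  incidence k F (F :\ x) =
    (-1) ^+ #|[set y in F | (enum_rank y < enum_rank x)%N]|.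
Proof.
move=> xF; rewrite /incidence (bigD1 x) /=; last by rewrite xF eqxx.
rewrite big1 ?addr0 // => y /andP[/andP[yF /eqP/setP/(_ y) yP] yx].
by move: yP; rewrite !inE eqxx yF yx.
Qed.

Lemma card_face i (F : face K i) : (#|val F|)%:Z = i + 1.
Proof. by have /andP[_ /eqP] := valP F; lia. Qed.

(* At a ridge of a facet carrying a nonzero coefficient, the boundary of the
   cycle vanishes, so a second facet through that ridge must contribute. *)
Lemma cycle_exchange (i : int) (z : chain_group k K i) (F : face K i) (x : L) :
  boundary (i - 1) z = 0 -> z F != 0 -> x \in val F ->
  exists F' : face K i, exists y,
    [/\ z F' != 0, y != x, y \in val F' & val F' :\ y = val F :\ x].
Proof.
move=> z0 zF xF.
have hG : (val F :\ x \in K) && (#|val F :\ x|%:Z - 1 == i - 1).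
  have /andP[FK /eqP cF] := valP F; apply/andP; split.
    move: FK; rewrite !inE => /andP[/forall_inP cF' sF].
    rewrite (subset_trans (subD1set _ _) sF) andbT.
    apply/forall_inP => a /setD1P[_ aF]; apply/forall_inP => b /setD1P[_ bF].
    by move: (cF' a aF) => /forall_inP; apply.
  move: cF; rewrite (cardsD1 x (val F)) xF add1n.
  by move: #|_| => c; lia.
pose G : face K (i - 1) := Sub (val F :\ x) hG.
have /ffunP/(_ G) := z0; rewrite !ffunE (bigD1 F) //= => sum0.
have : [exists F' : face K i, (F' != F) && (incidence k (val F') (val G) * z F' != 0)].
  apply: contraT => /existsPn none; move: sum0; rewrite big1 ?addr0; last first.
    by move=> F' nF; have := none F'; rewrite nF negbK => /eqP.
  (* The coefficient of [F] at the ridge is a sign, hence invertible in any ring, so a lone term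
     would force [z F = 0]. *)
  rewrite incidenceD1 // => /(canRL (signrMK _)) zF0.
  by rewrite zF0 mulr0 eqxx in zF.
case/existsP=> F' /andP[nF nz]; exists F'.
have zF' : z F' != 0 by apply: contraNneq nz => ->; rewrite mulr0.
have : incidence k (val F') (val G) != 0.
  by apply: contraNneq nz => ->; rewrite mul0r.
move/incidence_neq0=> [y yF' eG]; exists y; split=> //.
(* Both facets arise from the same ridge by adding one vertex, so [y = x] would make them equal. *)
apply: contraNneq nF => yx; apply/eqP/val_inj.
by rewrite -(setD1K yF') eG -(setD1K xF) yx.
Qed.

(** An exchange of facets only equates the remaining vertex sets; for the family it must also be
    shown that the new vertex takes the position of the old one. *)
Lemma cycle_support_thick (z : chain_group k K (n%:Z - 2)) :
  boundary (n%:Z - 2 - 1) z = 0 -> z != 0 ->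
  thick (fun s => path (@covered_by d L) \bot%O (rcons s \top%O) /\
                  exists2 F : face K (n%:Z - 2), s =i val F & z F != 0)
    \bot%O \top%O.
Proof.
move=> z0 znz; have satF (F : face K (n%:Z - 2)) :
    exists2 s, path (@covered_by d L) \bot%O (rcons s \top%O) & s =i val F.
  apply: (graded_chain_saturated n_gt0 gradedL); first by have /andP[] := valP F.
  by have := card_face F; move: #|_| => c; lia.
split.
- have /existsP[F zF] : [exists F, z F != 0].
    apply: contraNT znz => /existsPn zF; apply/eqP/ffunP => F.
    by rewrite ffunE; apply/eqP; rewrite -[_ == _]negbK zF.
  by have [s ps sF] := satF F; exists s; split=> //; exists F.
- by move=> s [].
move=> s1 x s2 [ps [F sF zF]].
have xF : x \in val F by rewrite -sF mem_cat mem_head orbT.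
have [F' [y [zF' yx yF' eG]]] := cycle_exchange z0 zF xF.
exists y => //.
have [s' ps' s'F] := satF F'.
have ys' : y \in s' by rewrite s'F.
case/splitPr: ys' ps' s'F => t1 t2 ps' s'F.
suff [<- <-] : t1 = s1 /\ t2 = s2 by split=> //; exists F'.
have sub s : path (@covered_by d L) \bot%O (rcons s \top%O) -> sorted <%O s.
  by move/path_covered_lt/path_sorted; rewrite lt_sorted_rconsE => /andP[].
have del (t t' : seq L) w : sorted <%O (t ++ w :: t') ->
    sorted <%O (t ++ t') /\ w \notin t ++ t'.
  move=> st; split; last first.
    have := lt_sorted_uniq st; rewrite -cat1s uniq_catCA /=.
    by case/andP.
  apply: subseq_sorted st; first exact: lt_trans.
  by rewrite cat_subseq // subseq_cons.
have [st nyt] := del _ _ _ (sub _ ps').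
have [ss nxs] := del _ _ _ (sub _ ps).
have eqt : t1 ++ t2 = s1 ++ s2.
  apply: lt_sorted_eq => // w; have /setP/(_ w) := eG.
  rewrite !in_setD1 -sF -s'F !mem_cat !in_cons !(orbCA _ (_ == _)) -!mem_cat.
  have nyw : w = y -> w \notin t1 ++ t2 by move->.
  have nxw : w = x -> w \notin s1 ++ s2 by move->.
  case: (eqVneq w y) => [/nyw/negPf->|_]; last first.
    by case: (eqVneq w x) => [/nxw/negPf->|].
  by case: (eqVneq w x) => [/nxw/negPf->|].
have rhoE (t t' : seq L) w :
    path (@covered_by d L) \bot%O (rcons (t ++ w :: t') \top%O) ->
    rho w = (size t).+1.
  rewrite -cat_rcons rcons_cat cat_path => /andP[/(rho_path rank_rho)].
  by rewrite last_rcons size_rcons rank_rho.1.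
(* A saturated chain runs through consecutive ranks, so the sum of the remaining ranks determines
   that of the deleted element. Hence [y] and [x] have equal rank, and by [rhoE] the same
   position. *)
have sumE (t t' : seq L) w :
    path (@covered_by d L) \bot%O (rcons (t ++ w :: t') \top%O) ->
    (rho w + sumn (map rho (t ++ t')) = sumn (iota 1 (size (t ++ t')).+1))%N.
  rewrite rcons_path => /andP[/(map_rho_path rank_rho)].
  have -> : size (t ++ w :: t') = (size (t ++ t')).+1.
    by rewrite !size_cat addnS.
  rewrite rank_rho.1 => <-.
  by rewrite !map_cat /= !sumn_cat /= addnCA.
have := sumE _ _ _ ps'; rewrite eqt -(sumE _ _ _ ps) => /addIn.
rewrite (rhoE _ _ _ ps') (rhoE _ _ _ ps) => -[size_eq].
by move/eqP: eqt; rewrite eqseq_cat // => /andP[/eqP-> /eqP->].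
Qed.

(** A representative of a nonzero class is a nonzero cycle. The rank of the top is read off a chain
    of its support, which has n - 1 elements between the bounds. *)
Lemma homology_thick :
  (exists h : reduced_homology k K (n%:Z - 2), h <> 0) ->
  rho \top%O = n /\ exists M, thick (L := L) M \bot%O \top%O.
Proof.
case; elim/quotW => z zn0.
have dz : boundary (n%:Z - 2 - 1) (val z) = 0.
  by apply/eqP; have := valP z; rewrite unfold_in.
have z_neq0 : val z != 0.
  apply/eqP => z0; apply: zn0.
  have -> : z = 0 by apply/val_inj.
  exact: raddf0.
have tM := cycle_support_thick dz z_neq0.
split; last by eexists; exact: tM.
have [[s [ps [F sF _]]] _ _] := tM.
have := rho_path rank_rho ps; rewrite last_rcons => ->.
have us : uniq s.
  have := lt_sorted_uniq (path_sorted (path_covered_lt ps)).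
  by rewrite rcons_uniq => /andP[].
have := card_face F; rewrite -(eq_card sF) (card_uniqP us) size_rcons rank_rho.1.
by move: (size s) => m; lia.
Qed.

End SupportOfCycle.

Theorem theorem1p1 (n : nat) (d : Order.disp_t) (L : finTBLatticeType d)
    (rho : L -> nat) (k : comNzRingType)
    (hn : (1 <= n)%N)
    (hL : graded_of_rank L n)
    (hrho : rank_function rho)
    (hk : field_or_Z k)
    (hH : exists h : reduced_homology k (order_complex (proper_part L)) (n%:Z - 2),
        h <> 0)
    (S : {set 'I_n}) (hS : forall s, s \in S -> (1 <= s)%N) :
  (alpha S <= flag_f rho S)%N.
Proof.
have [rho1 [M tM]] := homology_thick hn hL hrho hH.
have rho0 := hrho.1.
pose l := [seq val s | s <- enum S].
have lP r : reflect (exists2 s, s \in S & r = val s) (r \in l).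
  apply: (iffP mapP) => -[s sS ->]; exists s => //; by rewrite ?mem_enum // -mem_enum.
have pl : path ltn (rho \bot%O) (rcons l (rho \top%O)).
  rewrite rho0 rho1 (path_sortedE ltn_trans) all_rcons hn /=.
  apply/andP; split; first by apply/allP => r /lP[s /hS ? ->].
  rewrite (sorted_pairwise ltn_trans) pairwise_rcons.
  apply/andP; split; first by apply/allP => r /lP[s _ ->]; exact: ltn_ord.
  rewrite -(sorted_pairwise ltn_trans).
  (* Filtering the enumeration of ['I_n] by [S] keeps the order, so [l] is a subsequence of 0, ...,
     n - 1. *)
  apply: (subseq_sorted ltn_trans _ (iota_ltn_sorted 0 n)).
  rewrite -val_enum_ord; apply: map_subseq.
  by rewrite (enumT 'I_n); exact: filter_subseq.
have := leq_multinomial_flags hrho tM pl.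
rewrite rho0 rho1 => /leq_trans; apply; apply: subset_leq_card.
apply/subsetP=> C /flags_aboveP[cC hC hl]; rewrite inE cC /=.
apply/and3P; split.
(* The top is excluded because it has rank [n], while ranks in [l] are smaller. *)
- apply/subsetP => x /hC[x0 /lP[s _ rx]]; rewrite inE (gt_eqF x0) /=.
  by apply/eqP => x1; move: (ltn_ord s); rewrite -[nat_of_ord s]rx x1 rho1 ltnn.
- apply/forall_inP => x /hC[_ /lP[s sS ->]]; apply/exists_inP.
  by exists s.
apply/forall_inP => s sS; have [|x xC rx] := hl (val s).
  by apply/lP; exists s.
by apply/exists_inP; exists x => //; apply/eqP.
Qed.
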